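(* Let $N\ge 1$ be an integer and let $k(1),k(2),\dots,k(N-1)$ be integers satisfying $j<k(j)\le N$ for each $j=1,\dots,N-1$. For any such choice of the $k(j)$'s, there uniquely exists an optimal vertex algorithm $H\in\mathcal H_\star(N-1)$ such that, for each $j=1,\dots,N-1$, $$\lambda^\star_{k(j),j}(H)>0\quad\text{and}\quad \lambda^\star_{\ell,j}(H)=0\ \text{ for all } \ell\ne k(j),\ j<\ell\le N .$$
   Context: Algorithms. Let $N\ge 1$ be an integer. An H-matrix of size $N-1$ is a real lower triangular matrix $H=(h_{k,j})_{1\le j\le k\le N-1}$ (for $N=1$ it is the empty $0\times 0$ matrix). Given a real Hilbert space $\mathcal X$, an operator $T:\mathcal X\to\mathcal X$ and $y_0\in\mathcal X$, the algorithm defined by $H$ generates $y_{k+1}=y_k-\sum_{j=0}^{k}h_{k+1,j+1}(y_j-Ty_j)$ for $k=0,\dots,N-2$. $T$ is nonexpansive if $\|Tx-Ty\|\le\|x-y\|$ for all $x,y\in\mathcal X$; $y_\star$ is a fixed point if $Ty_\star=y_\star$. $\mathcal H_\star(N-1)$ is the set of H-matrices of size $N-1$ such that $\|y_{N-1}-Ty_{N-1}\|^2\le 4\|y_0-y_\star\|^2/N^2$ for every real Hilbert space $\mathcal X$, every nonexpansive $T:\mathcal X\to\mathcal X$ with a fixed point $y_\star$ and every $y_0\in\mathcal X$. H-certificates. For $m,j\in\{1,\dots,N-1\}$ let $Q(m,j;H)=\sum\prod_{r=1}^m h_{i(r),j(r)}$, the sum over all integers $j=j(1)\le i(1)<j(2)\le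 i(2)<\cdots<j(m)\le i(m)\le N-1$ (an empty sum is $0$). The H-certificates of $H$ are $\lambda^\star_{N,j}(H)=N\sum_{m=1}^{N-1}(-1)^{m-1}Q(m,j;H)$ for $1\le j\le N-1$, and $\lambda^\star_{k,j}(H)=N\sum_{\ell=1}^{N-1}\sum_{m=1}^{N-1}(-1)^{\ell+m-1}\binom{\ell+m}{m}Q(\ell,j;H)Q(m,k;H)$ for $1\le j<k\le N-1$. Known fact (Yoon–Ryu–Grimmer): $H\in\mathcal H_\star(N-1)$ if and only if $\sum_{j=1}^{N-1}Q(k,j;H)=\frac1N\binom{N}{k+1}$ for $k=1,\dots,N-1$ and $\lambda^\star_{k,j}(H)\ge 0$ for all $1\le j<k\le N$. Vertices. An optimal vertex algorithm (vertex of $\mathcal H_\star(N-1)$) is an $H\in\mathcal H_\star(N-1)$ such that for each $j=1,\dots,N-1$ there is exactly one index $k\in\{j+1,\dots,N\}$ with $\lambda^\star_{k,j}(H)>0$. *)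

(* Defs.v *)
From HB Require Import structures.
From mathcomp Require Import all_boot all_order all_algebra.
From mathcomp Require Import all_classical all_reals all_analysis.

Set Implicit Arguments.
Unset Strict Implicit.
Unset Printing Implicit Defensive.

Import Order.TTheory GRing.Theory Num.Theory.
Import numFieldNormedType.Exports.

Local Open Scope ring_scope.

(* The H-matrix (h_{k,j})_{1 <= j <= k <= N-1} is a lower
   triangular H : 'M[R]_N.-1, and every row, column and certificate index is
   shifted to start at 0: the entry h_{k+1,j+1} is H k j, and k : 'I_N stands
   for the 1-based index k+1 in {1, ..., N}.  The number of factors m of
   Q(m, j; H) and the sum indices ell, m below are not shifted. *)

Definition nonexpansive (R : realType) (X : normedModType R) (T : X -> X) : Prop :=
  forall x y : X, `|T x - T y| <= `|x - y|.

(* Only y 0, ..., y N.-1 are constrained, and they are determined by y0. *)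
Definition generates (R : realType) (X : normedModType R) (N : nat)
    (H : 'M[R]_N.-1) (T : X -> X) (y0 : X) (y : nat -> X) : Prop :=
  y 0%N = y0 /\
  forall k : 'I_N.-1,
    y k.+1 = y k - \sum_(j < N.-1 | (j <= k)%N) H k j *: (y j - T (y j)).

(* A real Hilbert space is a complete normed module whose norm comes from an
   inner product, i.e. a symmetric positive definite bilinear form. *)
Definition Hstar (R : realType) (N : nat) (H : 'M[R]_N.-1) : Prop :=
  is_trig_mx H /\
  forall (X : completeNormedModType R) (dot : {dot X for idfun}),
    (forall x : X, `|x| ^+ 2 = dot x x) ->
    forall (T : X -> X) (ystar y0 : X) (y : nat -> X),
      nonexpansive T -> T ystar = ystar -> generates H T y0 y ->
      `|y N.-1 - T (y N.-1)| ^+ 2 <= 4 * `|y0 - ystar| ^+ 2 / N%:R ^+ 2.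

(* A term of Q(m, j; H) is given by the tuple s of the pairs (i(r), j(r)). *)
Definition Q (R : realType) (n : nat) (H : 'M[R]_n) (m j : nat) : R :=
  \sum_(s : m.-tuple ('I_n * 'I_n) |
      [&& ohead [seq val p.2 | p : 'I_n * 'I_n <- s] == Some j,
          all (fun p : 'I_n * 'I_n => p.2 <= p.1)%N s
        & sorted (fun p q : 'I_n * 'I_n => p.1 < q.2)%N s])
    \prod_(p <- s) H p.1 p.2.

(* The H-certificates; k = N.-1 is the 1-based index N. *)
Definition lambda (R : realType) (N : nat) (H : 'M[R]_N.-1)
    (k : 'I_N) (j : 'I_N.-1) : R :=
  if k == N.-1 :> nat then
    N%:R * \sum_(1 <= m < N) (-1) ^+ m.-1 * Q H m j
  else
    N%:R * \sum_(1 <= l < N) \sum_(1 <= m < N)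
      (-1) ^+ (l + m).-1 * 'C(l + m, m)%:R * Q H l j * Q H m k.

Definition optimal_vertex (R : realType) (N : nat) (H : 'M[R]_N.-1) : Prop :=
  Hstar H /\
  forall j : 'I_N.-1, exists! k : 'I_N, (j < k)%N /\ 0 < lambda H k j.

(* Main.v *)
(* Write q_j(w) = sum_{m >= 1} Q(m, j; H) (w - 1)^m for j < N and q_N = 1, as
   vectors of coefficients in the powers of w.  By Vandermonde's identity the
   vectors (w - 1)^l and (w - 1)^m have inner product
   (-1)^(l + m) 'C(l + m, m), so lambda_{k,j} = - N <q_k, q_j>: the certificates
   are the off-diagonal entries of a Gram matrix.  The definition of Q becomes
   q_j = (w - 1) sum_{i >= j} h_{i,j} sum_{l > i} q_l, which identifies H with
   the family q as soon as deg q_j = N - j.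

   H is optimal iff sum_j q_j = (1 + w + ... + w^(N-1)) / N and lambda >= 0.
   Sufficiency: the sum condition makes the Gram matrix a grounded Laplacian,
   and multiplication by w preserves inner products, which turns the weighted
   sum of the nonexpansiveness inequalities into a sum of telescoping squares.
   Necessity of the sum condition: run the algorithm on the negacyclic shift of
   R^N from (1, ..., 1); its residual is twice the coefficient vector of
   sum_j q_j, whose entries add up to 1 and have square sum at most 1 / N.

   For a prescribed k(.), each q_j is determined up to a positive factor by
   q_{j+1}, ..., q_N through orthogonality, and the factors are the coordinates
   of (1 + w + ... + w^(N-1)) / N, positive by an M-matrix argument. *)

Require Import Defs.
From HB Require Import structures.
From mathcomp Require Import all_boot all_order all_algebra.
From mathcomp Require Import all_classical all_reals all_analysis.
From mathcomp Require Import ring lra zify.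
Import Order.TTheory GRing.Theory Num.Theory.
Import numFieldNormedType.Exports.
Local Open Scope ring_scope.

Set Implicit Arguments.
Unset Strict Implicit.
Unset Printing Implicit Defensive.

(** * Inner products of coefficient vectors and sparse families *)

Section CoefInner.
Variables (R : realFieldType) (N : nat).
Implicit Types p r : {poly R}.

(** The sum stops below [N], so this form is definite only on polynomials of size at most [N]. *)
Definition ip p r : R := \sum_(i < N) p`_i * r`_i.

Lemma ipC p r : ip p r = ip r p.
Proof. by apply: eq_bigr => i _; rewrite mulrC. Qed.

Lemma ipDl p1 p2 r : ip (p1 + p2) r = ip p1 r + ip p2 r.
Proof. by rewrite /ip -big_split; apply: eq_bigr => i _; rewrite coefD mulrDl. Qed.

Lemma ipZl a p r : ip (a *: p) r = a * ip p r.
Proof. by rewrite /ip mulr_sumr; apply: eq_bigr => i _; rewrite coefZ mulrA. Qed.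

Lemma ipZr a p r : ip p (a *: r) = a * ip p r.
Proof. by rewrite ipC ipZl ipC. Qed.

Lemma ipBl p1 p2 r : ip (p1 - p2) r = ip p1 r - ip p2 r.
Proof. by rewrite -scaleN1r ipDl ipZl mulN1r. Qed.

Lemma ip_suml I (s : seq I) (P : pred I) (F : I -> {poly R}) r :
  ip (\sum_(i <- s | P i) F i) r = \sum_(i <- s | P i) ip (F i) r.
Proof.
apply: (big_morph (ip^~ r)) => [p1 p2|]; first exact: ipDl.
by rewrite /ip big1// => i _; rewrite coef0 mul0r.
Qed.

Lemma ip_sumr I (s : seq I) (P : pred I) (F : I -> {poly R}) r :
  ip r (\sum_(i <- s | P i) F i) = \sum_(i <- s | P i) ip r (F i).
Proof. by rewrite ipC ip_suml; apply: eq_bigr => i _; rewrite ipC. Qed.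

Lemma ip_ge0 p : 0 <= ip p p.
Proof. by apply: sumr_ge0 => i _; rewrite -expr2 sqr_ge0. Qed.

Lemma ip_le0 p : (size p <= N)%N -> ip p p <= 0 -> p = 0.
Proof.
move=> sp p0; have /eqP : ip p p = 0 by apply/eqP; rewrite eq_le p0 ip_ge0.
rewrite psumr_eq0 => [/allP h|i _]; last by rewrite -expr2 sqr_ge0.
apply/polyP => i; rewrite coef0; case: (ltnP i N) => iN; last first.
  by rewrite nth_default// (leq_trans sp).
have := h (Ordinal iN) (mem_index_enum _).
by rewrite /= -expr2 sqrf_eq0 => /eqP.
Qed.

Lemma ipXn p i : (i < N)%N -> ip p 'X^i = p`_i.
Proof.
move=> iN; rewrite /ip (bigD1 (Ordinal iN))//= coefXn eqxx mulr1.
rewrite big1 ?addr0// => j ji; rewrite coefXn.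
by rewrite (_ : (j == i :> nat) = false) ?mulr0//; apply/negbTE.
Qed.

Definition ones m : {poly R} := \sum_(i < m) 'X^i.

(** Each monomial picks out one coefficient. This turns vanishing at 1 into orthogonality to [ones],
    and back. *)
Lemma ip_ones p m : (size p <= m)%N -> (m <= N)%N -> ip p (ones m) = p.[1].
Proof.
move=> pm mN; rewrite ip_sumr (horner_coef_wide _ pm).
by apply: eq_bigr => i _; rewrite ipXn ?expr1n ?mulr1// (leq_trans _ mN).
Qed.

Lemma coef_ones m i : (ones m)`_i = (i < m)%:R.
Proof.
rewrite /ones coef_sum; case: ltnP => im.
  rewrite (bigD1 (Ordinal im))//= coefXn eqxx big1 ?addr0// => j.
  by rewrite -val_eqE /= coefXn eq_sym => /negPf ->.
by rewrite big1// => j _; rewrite coefXn gtn_eqF// (leq_trans _ im).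
Qed.

Lemma size_ones m : (size (ones m) <= m)%N.
Proof.
apply: (leq_trans (size_sum _ _ _)); apply/bigmax_leqP => i _.
by rewrite size_polyXn.
Qed.

Lemma ones1 m : (ones m).[1] = m%:R.
Proof.
rewrite horner_sum; under eq_bigr do rewrite hornerXn expr1n.
by rewrite sumr_const card_ord.
Qed.

End CoefInner.

(** * Polynomial families of strictly decreasing degree *)

Section Triangular.
Variables (R : realFieldType) (N : nat) (b : nat -> {poly R}).

Lemma tri_lead j : size (b j) = (N - j)%N -> (j < N)%N -> (b j)`_(N - j.+1) != 0.
Proof.
move=> sb jN; have -> : (N - j.+1 = (size (b j)).-1)%N by rewrite sb; lia.
by rewrite -lead_coefE lead_coef_eq0 -size_poly_eq0 sb; lia.
Qed.

(** Gaussian elimination from the top: a multiple of [b j] removes the coefficient of degree N - j -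
    1, and the remainder falls to the later members. *)
Lemma tri_span j (p : {poly R}) :
  (j <= N)%N -> (forall i, (j <= i < N)%N -> size (b i) = (N - i)%N) ->
  (size p <= N - j)%N ->
  exists c : nat -> R, p = \sum_(j <= i < N) c i *: b i.
Proof.
move=> jN; have [d jdN] : exists d, (j + d = N)%N by exists (N - j)%N; lia.
elim: d j {jN} jdN p => [|d IH] j jdN p sb sp.
  exists (fun=> 0); rewrite big_geq; last by lia.
  by apply/eqP; rewrite -size_poly_eq0; lia.
have sbj : size (b j) = (N - j)%N by apply: sb; lia.
have bj0 := @tri_lead j sbj ltac:(lia).
pose a := p`_(N - j.+1) / (b j)`_(N - j.+1).
have [|||c pc] := IH j.+1 _ (p - a *: b j).
- by lia.
- by move=> i ij; apply: sb; lia.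
- have sr : (size (p - a *: b j)%R <= (N - j.+1).+1)%N.
    rewrite (leq_trans (size_polyD _ _))// geq_max size_polyN.
    by rewrite (leq_trans (size_scale_leq _ _)) ?andbT ?sbj; lia.
  apply/leq_sizeP => i; rewrite leq_eqVlt => /orP[/eqP <-|ij].
    by rewrite coefB coefZ /a divfK ?subrr.
  by rewrite nth_default// (leq_trans sr).
exists (fun i => if i == j then a else c i).
rewrite big_ltn ?eqxx; last by lia.
rewrite -[LHS](subrK (a *: b j)) pc addrC; congr (_ + _).
by apply: eq_big_nat => i ij; rewrite ifN//; lia.
Qed.

(** Only [b j] reaches degree N - j - 1, so its factor vanishes first. *)
Lemma tri_free j (c : nat -> R) :
  (forall i, (j <= i < N)%N -> size (b i) = (N - i)%N) ->
  \sum_(j <= i < N) c i *: b i = 0 -> forall i, (j <= i < N)%N -> c i = 0.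
Proof.
case: (leqP j N) => [jN|]; last by lia.
have [d jdN] : exists d, (j + d = N)%N by exists (N - j)%N; lia.
elim: d j {jN} jdN => [|d IH] j jdN sb s0 i ijN; first by lia.
have sbj : size (b j) = (N - j)%N by apply: sb; lia.
have bj0 := @tri_lead j sbj ltac:(lia).
move: s0; rewrite big_ltn; last by lia.
move=> s0; have cj : c j = 0.
  apply: (mulIf bj0); rewrite mul0r -coefZ.
  have /(congr1 (fun p : {poly R} => p`_(N - j.+1))) := s0.
  rewrite coefD coef0 coef_sum big_nat big1 ?addr0// => l lj.
  by rewrite coefZ nth_default ?mulr0// sb; lia.
move: s0; rewrite cj scale0r add0r => s0.
have [->//|ij] := eqVneq i j.
by apply: (IH j.+1) => // [|l lj|]; [lia|apply: sb; lia|lia].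
Qed.

(** A monomial of degree N - j - 1 is orthogonal to every [b i] with i > j, so adding it adjusts the
    product with [b j] alone. *)
Lemma tri_dual j (c : nat -> R) :
  (j <= N)%N -> (forall i, (j <= i < N)%N -> size (b i) = (N - i)%N) ->
  exists2 v : {poly R}, (size v <= N - j)%N &
    forall i, (j <= i < N)%N -> ip N v (b i) = c i.
Proof.
move=> jN; have [d jdN] : exists d, (j + d = N)%N by exists (N - j)%N; lia.
elim: d j {jN} jdN => [|d IH] j jdN sb.
  by exists 0 => [|i]; rewrite ?size_poly0//; lia.
have sbj : size (b j) = (N - j)%N by apply: sb; lia.
have bj0 := @tri_lead j sbj ltac:(lia).
have [||v sv vc] := IH j.+1; [by lia|by move=> i ij; apply: sb; lia|].
pose a := (c j - ip N v (b j)) / (b j)`_(N - j.+1).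
exists (v + a *: 'X^(N - j.+1)) => [|i ij].
  rewrite (leq_trans (size_polyD _ _))// geq_max.
  rewrite (leq_trans (size_scale_leq _ _)) ?andbT ?size_polyXn; lia.
rewrite ipDl ipZl (ipC _ 'X^_) ipXn; last by lia.
have [->|ne] := eqVneq i j; first by rewrite /a divfK// addrC subrK.
by rewrite vc; [rewrite nth_default ?mulr0 ?addr0// sb; lia|lia].
Qed.

End Triangular.

(** * Families of polynomials with a prescribed orthogonality pattern *)

Section SparseFamilies.
Variables (R : realFieldType) (n : nat) (k : nat -> nat).
Hypothesis hk : forall i, (i < n)%N -> (i < k i <= n)%N.
Local Notation "'<< p , r >>" := (ip n.+1 p r) (at level 0, format "''<<' p ,  r '>>'").

(** These are the demands on the certificate polynomials apart from the sum condition. The lower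
    bound [j] allows a construction from the root [n] downwards. *)
Record sparse_family (j : nat) (u : nat -> {poly R}) : Prop := SparseFamily {
  sparse_root : u n = 1;
  sparse_size : forall i, (j <= i <= n)%N -> size (u i) = (n.+1 - i)%N;
  sparse_at1 : forall i, (j <= i < n)%N -> (u i).[1] = 0;
  sparse_orth : forall i l, (j <= i < l)%N -> (l <= n)%N -> l != k i ->
    '<<u l, u i>> = 0;
  sparse_neg : forall i, (j <= i < n)%N -> '<<u (k i), u i>> < 0 }.

Lemma sparse_offdiag j u i l : sparse_family j u ->
  (j <= i <= n)%N -> (j <= l <= n)%N -> i != l -> '<<u i, u l>> <= 0.
Proof.
move=> su; wlog il : i l / (i < l)%N.
  by move=> H ji jl il; case: (ltngtP i l) il => // il _; [|rewrite ipC]; apply: H; lia.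
move=> ji jl _; rewrite ipC; have [->|lk] := eqVneq l (k i).
  by apply/ltW/(sparse_neg su); lia.
by rewrite (sparse_orth su)//; lia.
Qed.

(* The Gram matrix of the family has nonpositive off-diagonal entries and
   [ones] is orthogonal to every member except the root: its coordinates are
   positive by the usual M-matrix argument. *)
Lemma sparse_ones_pos j u (c : nat -> R) : sparse_family j u -> (j <= n)%N ->
  ones R (n.+1 - j) = \sum_(j <= i < n.+1) c i *: u i ->
  c n = (n.+1 - j)%:R /\ forall i, (j <= i <= n)%N -> 0 < c i.
Proof.
move=> su jn e.
have sz i : (j <= i <= n)%N -> (size (u i) <= n.+1 - j)%N.
  by move=> ji; rewrite (sparse_size su)//; lia.
have inner i : (j <= i <= n)%N -> '<<ones R (n.+1 - j), u i>> = (i == n)%:R.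
  move=> ji; rewrite ipC ip_ones ?sz ?leq_subr//.
  have [->|ne] := eqVneq i n; first by rewrite (sparse_root su) hornerC.
  by rewrite (sparse_at1 su)//; lia.
have cn : c n = (n.+1 - j)%:R.
  rewrite -(ones1 R) e horner_sum big_nat_recr//= big_nat big1 ?add0r.
    by rewrite (sparse_root su) hornerZ hornerC mulr1.
  by move=> i ij; rewrite hornerZ (sparse_at1 su) ?mulr0.
have cn0 : 0 < c n by rewrite cn ltr0n; lia.
(* [m] is the negative part of [c], so [c + m] is the positive part and the two have disjoint
   supports. The combination [w] with coordinates [m] is shown to be zero. *)
pose m i := Num.max (- c i) 0.
have m0 i : 0 <= m i by rewrite /m le_max lexx orbT.
have cm0 i : 0 <= c i + m i by rewrite /m; case: (leP (- c i) 0) => ?; lra.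
have cmm i : (c i + m i) * m i = 0.
  by rewrite /m; case: (leP (- c i) 0) => ?; rewrite ?addrN ?mul0r ?mulr0.
pose w := \sum_(j <= i < n.+1) m i *: u i.
have w0 : w = 0.
  apply: (@ip_le0 _ n.+1).
    rewrite /w big_nat (leq_trans (size_sum _ _ _))//; apply/bigmax_leqP_seq => i _ ij.
    by apply: (leq_trans (size_scale_leq _ _)); apply: (leq_trans (sz i ij)); lia.
  have h1 : 0 <= '<<ones R (n.+1 - j), w>>.
    rewrite ip_sumr big_nat sumr_ge0// => i ij.
    by rewrite ipZr inner ?mulr_ge0.
  (* Diagonal terms vanish by disjoint supports; the others are nonnegative weights times
     nonpositive products. *)
  have h2 : '<<ones R (n.+1 - j) + w, w>> <= 0.
    rewrite e -big_split /= ip_suml big_nat; apply: sumr_le0 => i ij.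
    rewrite -scalerDl ipZl ip_sumr mulr_sumr big_nat; apply: sumr_le0 => l lj.
    rewrite ipZr mulrA; have [->|il] := eqVneq i l; first by rewrite cmm mul0r.
    by rewrite mulr_ge0_le0 ?mulr_ge0// (sparse_offdiag su).
  by move: h2; rewrite ipDl => h2; lra.
have c0 i : (j <= i <= n)%N -> 0 <= c i.
  move=> ij; have : m i = 0.
    by apply: (@tri_free R n.+1 u j m) w0 _ _ => // l lj; apply: (sparse_size su).
  by move=> mi; have := cm0 i; rewrite mi addr0.
(* Strict positivity descends from the root: if [c i] were 0, then [ones] paired with [u i] would be
   a sum of nonpositive terms, with a strictly negative one at [k i]. *)
split=> // i; have [d] := ubnP (n - i)%N; elim: d i => // d IH i nid ji.
have [->//|ne] := eqVneq i n.
have [iin kin] : (i < n)%N /\ (i < k i <= n)%N by split; [|apply: hk]; lia.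
rewrite lt_def c0// andbT; apply/eqP => ci.
have : '<<ones R (n.+1 - j), u i>> < 0; last by rewrite inner// (negPf ne) ltxx.
rewrite e ip_suml.
rewrite (big_cat_nat (n := k i)) /=; [|lia|lia].
rewrite [X in _ + X]big_ltn; last by lia.
have le0 l : (j <= l <= n)%N -> '<<c l *: u l, u i>> <= 0.
  move=> lj; rewrite ipZl; have [->|li] := eqVneq l i; first by rewrite ci mul0r.
  by rewrite mulr_ge0_le0 ?c0 ?(sparse_offdiag su).
have t1 : \sum_(j <= l < k i) '<<c l *: u l, u i>> <= 0.
  by rewrite big_nat sumr_le0// => l lj; apply: le0; lia.
have t2 : \sum_((k i).+1 <= l < n.+1) '<<c l *: u l, u i>> <= 0.
  by rewrite big_nat sumr_le0// => l lj; apply: le0; lia.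
have t3 : '<<c (k i) *: u (k i), u i>> < 0.
  by rewrite ipZl pmulr_rlt0 ?(sparse_neg su)//; [lia|apply: IH; lia].
lra.
Qed.

Lemma ones_span j u : sparse_family j u -> (j <= n)%N ->
  exists c : nat -> R, ones R (n.+1 - j) = \sum_(j <= i < n.+1) c i *: u i.
Proof.
move=> su jn; apply: tri_span; rewrite ?size_ones//; first by lia.
by move=> i ij; apply: (sparse_size su).
Qed.

(** The new member starts as a dual vector with value -1 at [u (k j)] and 0 at the other later
    members. A monomial of degree n - j is then added to make it vanish at 1; that degree is too
    high to affect the products with later members. *)
Lemma sparse_family_exists j : (j <= n)%N -> exists u, sparse_family j u.
Proof.
move=> jn; have [d dE] : exists d, (j + d = n)%N by exists (n - j)%N; lia.
elim: d j {jn} dE => [|d IH] j dE.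
  exists (fun=> 1); split=> // [i ij|i ij|i l ij|i ij]; try lia.
  by rewrite size_poly1; lia.
have [|u su] := IH j.+1; first by lia.
have [c e] := ones_span su ltac:(lia).
have [_ cpos] := sparse_ones_pos su ltac:(lia) e.
have kj : (j < k j <= n)%N by apply: hk; lia.
have [|v sv ev] := @tri_dual R n.+1 u j.+1 (fun l => - (l == k j)%:R) ltac:(lia).
  by move=> i ij; apply: (sparse_size su).
(* The value at 1 is the product with [ones], hence minus the coordinate of [ones] at [k j]. Being
   nonzero, it gives [w] its exact size. *)
have v1 : v.[1] < 0.
  rewrite -(@ip_ones R n.+1 v (n.+1 - j.+1)) ?leq_subr// e ip_sumr.
  rewrite (bigD1_seq (k j)) ?iota_uniq ?mem_index_iota//=.
  rewrite ipZr ev// eqxx mulrN mulr1 big_seq_cond big1 ?addr0.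
    by rewrite oppr_lt0 cpos.
  move=> i /andP[]; rewrite mem_index_iota => ij ik.
  by rewrite ipZr ev// (negPf ik) oppr0 mulr0.
pose w := v - v.[1] *: 'X^(n - j).
have sw : size w = (n.+1 - j)%N.
  rewrite /w addrC size_polyDl size_polyN size_scale ?lt_eqF// size_polyXn; lia.
have ipw l : (j < l <= n)%N -> '<<u l, w>> = - (l == k j)%:R.
  move=> lj; rewrite /w ipC ipBl ev// ipZl ipC ipXn; last by lia.
  by rewrite nth_default ?mulr0 ?subr0// (sparse_size su)//; lia.
exists (fun i => if i == j then w else u i); split.
- by rewrite ifN ?(sparse_root su)//; lia.
- by move=> i ij; have [->//|ne] := eqVneq i j; apply: (sparse_size su); lia.
- move=> i ij; have [_|ne] := eqVneq i j; last by apply: (sparse_at1 su); lia.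
  by rewrite /w hornerD hornerN hornerZ hornerXn expr1n mulr1 subrr.
- move=> i l ij ln lk; rewrite [if l == j then _ else _]ifN; last by lia.
  have [eij|ne] := eqVneq i j; last by apply: (sparse_orth su) => //; lia.
  by rewrite eij in lk *; rewrite ipw ?(negPf lk) ?oppr0//; lia.
- move=> i ij; have ki : (i < k i <= n)%N by apply: hk; lia.
  rewrite [if k i == j then _ else _]ifN; last by lia.
  have [->|ne] := eqVneq i j; last by apply: (sparse_neg su); lia.
  by rewrite ipw ?eqxx ?oppr_lt0//; lia.
Qed.

(** Positive rescaling preserves the sparsity pattern, so each member is scaled by its coordinate in
    [ones] over n + 1. The root has coordinate n + 1 and remains 1. *)
Lemma sparse_family_sum_exists :
  exists2 q, sparse_family 0 q & \sum_(0 <= i < n.+1) q i = n.+1%:R^-1 *: ones R n.+1.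
Proof.
have [u su] := @sparse_family_exists 0 isT.
have [c e] := ones_span su isT; rewrite subn0 in e.
have [cn cpos] := sparse_ones_pos su isT e.
have N0 : 0 < n.+1%:R^-1 :> R by rewrite invr_gt0.
have qpos i : (i <= n)%N -> 0 < n.+1%:R^-1 * c i by move=> ?; rewrite mulr_gt0// cpos.
exists (fun i => (n.+1%:R^-1 * c i) *: u i); last first.
  by rewrite e scaler_sumr; apply: eq_bigr => i _; rewrite scalerA.
split.
- by rewrite cn subn0 mulVf ?scale1r ?(sparse_root su)// pnatr_eq0.
- by move=> i ij; rewrite size_scale ?gt_eqF ?qpos ?(sparse_size su).
- by move=> i ij; rewrite hornerZ (sparse_at1 su)// mulr0.
- by move=> i l ij ln lk; rewrite ipZl ipZr (sparse_orth su)// !mulr0.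
- move=> i ij; have ki : (i < k i <= n)%N by apply: hk; lia.
  rewrite ipZl ipZr !pmulr_rlt0 ?qpos ?(sparse_neg su)//; lia.
Qed.

(** Descending induction makes each [q' i] a positive multiple of [q i]; equality of the sums and
    linear independence then force every factor to be 1. *)
Lemma sparse_family_unique (q q' : nat -> {poly R}) :
  sparse_family 0 q ->
  q' n = 1 ->
  (forall i, (i <= n)%N -> size (q' i) <= n.+1 - i)%N ->
  (forall i, (i < n)%N -> (q' i).[1] = 0) ->
  (forall i l, (i < l <= n)%N -> l != k i -> '<<q' l, q' i>> = 0) ->
  (forall i, (i < n)%N -> '<<q' (k i), q' i>> < 0) ->
  \sum_(0 <= i < n.+1) q i = \sum_(0 <= i < n.+1) q' i ->
  forall i, (i <= n)%N -> q' i = q i.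
Proof.
move=> sq q'n q's q'1 q'o q'neg sumE.
have prop i : (i <= n)%N -> exists2 a, 0 < a & q' i = a *: q i.
  have [d] := ubnP (n - i)%N; elim: d i => // d IH i nid iN.
  have [->|ne] := eqVneq i n; first by exists 1; rewrite // q'n scale1r (sparse_root sq).
  have ltin : (i < n)%N by lia.
  have ki := hk ltin.
  have [b b0 qk] := IH (k i) ltac:(lia) ltac:(lia).
  have neg := @sparse_neg _ _ sq i ltin.
  (* This ratio makes [q' i - a *: q i] orthogonal to [q (k i)], and so to all later members. *)
  pose a := '<<q (k i), q' i>> / '<<q (k i), q i>>.
  have neg' : '<<q (k i), q' i>> < 0.
    by have := q'neg i ltin; rewrite qk ipZl pmulr_rlt0.
  have a0 : 0 < a by rewrite /a nmulr_rgt0// invr_lt0.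
  exists a => //; pose r := q' i - a *: q i.
  have rorth l : (i < l <= n)%N -> '<<r, q l>> = 0.
    move=> il; rewrite /r ipBl ipZl ipC (ipC _ (q i)).
    have [->|lk] := eqVneq l (k i); first by rewrite /a divfK ?subrr// lt_eqF.
    rewrite (sparse_orth sq) ?mulr0 ?subr0//; try lia.
    have [bl bl0 ql] := IH l ltac:(lia) ltac:(lia).
    by have /eqP := q'o i l il lk; rewrite ql ipZl mulf_eq0 gt_eqF//= => /eqP.
  have sr : (size r <= n.+1 - i)%N.
    rewrite (leq_trans (size_polyD _ _))// geq_max size_polyN q's//=.
    by rewrite (leq_trans (size_scale_leq _ _))// (sparse_size sq).
  (* Without its top monomial, [r] lies in the span of the later members, to which [r] is
     orthogonal. The monomial is orthogonal to [r'] by degree, so [r'] has norm zero; the value at 1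
     then kills [al]. *)
  pose al := r`_(n - i); pose r' := r - al *: 'X^(n - i).
  have sr' : (size r' <= n.+1 - i.+1)%N.
    apply/leq_sizeP => m; rewrite subSS leq_eqVlt => /orP[/eqP <-|im].
      by rewrite coefB coefZ coefXn eqxx mulr1 subrr.
    rewrite coefB coefZ coefXn (gtn_eqF im) mulr0 subr0 nth_default//.
    by rewrite (leq_trans sr)//; lia.
  have [c cE] : exists c : nat -> R, r' = \sum_(i.+1 <= l < n.+1) c l *: q l.
    by apply: tri_span => // x xi; apply: (sparse_size sq); lia.
  have r'0 : r' = 0.
    apply: (@ip_le0 _ n.+1); first by lia.
    have -> : '<<r', r'>> = '<<r, r'>>; last first.
      by rewrite cE ip_sumr big_nat big1// => l il; rewrite ipZr rorth ?mulr0.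
    rewrite {1}/r' ipBl ipZl (ipC _ 'X^_) ipXn; last by lia.
    by rewrite (nth_default _ (leq_trans sr' _)) ?mulr0 ?subr0//; lia.
  have rE : r = al *: 'X^(n - i) by apply/eqP; rewrite -subr_eq0; apply/eqP.
  have al0 : al = 0.
    have : r.[1] = 0 by rewrite /r hornerD hornerN hornerZ q'1// (sparse_at1 sq)// mulr0 subrr.
    by rewrite rE hornerZ hornerXn expr1n mulr1.
  by apply/eqP; rewrite -subr_eq0 -/r rE al0 scale0r.
(* The factor is rewritten as a projection coefficient to make it a function of the index. *)
pose a i := '<<q' i, q i>> / '<<q i, q i>>.
have qa i : (i <= n)%N -> q' i = a i *: q i.
  move=> iN; have [b b0 e] := prop i iN.
  have q0 : '<<q i, q i>> != 0.
    apply/eqP => /eqP; rewrite eq_le => /andP[/ip_le0 q0 _].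
    have := @sparse_size _ _ sq i iN; rewrite q0 ?size_poly0; first by lia.
    by rewrite (sparse_size sq)//; lia.
  by rewrite {1}e /a e ipZl mulfK.
move=> i iN; suff : a i - 1 = 0 by move=> /subr0_eq a1; rewrite qa// a1 scale1r.
apply: (@tri_free R n.+1 q 0%N (fun i => a i - 1)) => //.
  by move=> l ln; apply: (sparse_size sq).
apply/eqP; under eq_bigr do rewrite scalerBl scale1r; rewrite sumrB subr_eq0; apply/eqP.
by rewrite sumE big_nat [RHS]big_nat; apply: eq_bigr => l ln; rewrite qa.
Qed.

End SparseFamilies.

(** * The certificate polynomials *)

Lemma big_tupleS (R : Type) (idx : R) (op : Monoid.com_law idx) (T : finType)
    m (P : pred (seq T)) (F : seq T -> R) :
  \big[op/idx]_(s : m.+1.-tuple T | P s) F s =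
  \big[op/idx]_(x : T) \big[op/idx]_(s : m.-tuple T | P (x :: s)) F (x :: s).
Proof.
rewrite pair_big_dep /= (reindex (fun p : T * m.-tuple T => [tuple of p.1 :: p.2])) /=.
  by apply: eq_big => -[x t].
exists (fun s : m.+1.-tuple T => (thead s, [tuple of behead s])) => [[x t] _|s _] /=.
  by rewrite theadE; congr (_, _); apply: val_inj.
by apply: val_inj; rewrite /= [in RHS](tuple_eta s).
Qed.

Section QRecursion.
Variables (R : realType) (n : nat) (H : 'M[R]_n).

(** Sum over the chains of [m] pairs that may follow a pair with row index [i]; [path] reads this
    bound from the first component of the artificial pair [(i, i)]. *)
Let Qtail (m : nat) (i : 'I_n) : R :=
  \sum_(s : m.-tuple ('I_n * 'I_n) |
      all (fun p : 'I_n * 'I_n => p.2 <= p.1)%N s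
      && path (fun p q : 'I_n * 'I_n => p.1 < q.2)%N (i, i) s)
    \prod_(p <- s) H p.1 p.2.

Let Qtail0 i : Qtail 0 i = 1.
Proof.
rewrite /Qtail (bigD1 [tuple])//= big_nil big1 ?addr0// => s.
by rewrite (tuple0 s) => /andP[_ /eqP[]].
Qed.

(** The condition [P] on the first column index covers both uses: a fixed index gives [Q], indices
    above [i] give [Qtail]. *)
Let tuple_split m (P : pred 'I_n) :
  \sum_(s : m.+1.-tuple ('I_n * 'I_n) |
      [&& (if (s : seq _) is p :: _ then P p.2 else false),
          all (fun p : 'I_n * 'I_n => p.2 <= p.1)%N s
        & sorted (fun p q : 'I_n * 'I_n => p.1 < q.2)%N s])
    \prod_(p <- s) H p.1 p.2 =
  \sum_(l | P l) \sum_(i < n | (l <= i)%N) H i l * Qtail m i.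
Proof.
rewrite (big_tupleS _ m (fun s : seq ('I_n * 'I_n) =>
  [&& (if s is p :: _ then P p.2 else false), 
    all (fun p : 'I_n * 'I_n => p.2 <= p.1)%N s
   & sorted (fun p q : 'I_n * 'I_n => p.1 < q.2)%N s]) (fun s => \prod_(p <- s) H p.1 p.2)) /=.
transitivity (\sum_(x : 'I_n * 'I_n | P x.2 && (x.2 <= x.1)%N)
    H x.1 x.2 * Qtail m x.1).
  rewrite [RHS]big_mkcond; apply: eq_bigr => -[i l] _ /=; case: ifP => Pl; last first.
    by rewrite big_pred0// => s; rewrite andbA andbA Pl.
  have [-> ->] := andP Pl; rewrite mulr_sumr; apply: eq_big => [s|s _].
    by case: (tval s).
  by rewrite big_cons.
rewrite pair_big_dep /= (reindex (fun x : 'I_n * 'I_n => (x.2, x.1))) //=.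
by exists (fun x : 'I_n * 'I_n => (x.2, x.1)) => -[].
Qed.

Let QS m j : Q H m.+1 j =
  \sum_(l < n | l == j :> nat) \sum_(i < n | (l <= i)%N) H i l * Qtail m i.
Proof. by rewrite -tuple_split; apply: eq_bigl => -[[]]. Qed.

Let QS_ord m (j : 'I_n) : Q H m.+1 j =
  \sum_(i < n | (j <= i)%N) H i j * Qtail m i.
Proof. by rewrite QS (big_pred1 j)// => l; rewrite -val_eqE. Qed.

Let QtailS m i : Qtail m.+1 i = \sum_(l < n | (i < l)%N) Q H m.+1 l.
Proof.
under eq_bigr do rewrite QS_ord.
by rewrite -tuple_split; apply: eq_bigl => -[[|p s] //= _]; rewrite andbCA.
Qed.

(** The column indices of a chain increase strictly from [j] and stay below [n], so longer chains do
    not exist. *)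
Lemma Q_eq0 m j : (0 < m)%N -> (n < m + j)%N -> Q H m j = 0.
Proof.
case: m => // m _; elim: m j => [|m IH] j h; rewrite QS big1// => l /eqP lj.
  by have := ltn_ord l; lia.
rewrite big1// => i li; rewrite QtailS big1 ?mulr0// => x xi.
by apply: IH; lia.
Qed.

(* [certp j] is q_{j+1} of the header: indices start at 0 and the root is
   [n] = N - 1. *)
Definition certp (j : nat) : {poly R} :=
  if j == n then 1 else \sum_(1 <= m < n.+1) Q H m j *: ('X - 1) ^+ m.

Lemma certp_root : certp n = 1.
Proof. by rewrite /certp eqxx. Qed.

(** The empty chain accounts for the root; nonempty ones are sorted by their first column index.
    Stopping at m < n loses nothing, since chains of length [n] cannot start after [i]. *)
Lemma Qtail_certp (i : 'I_n) :
  \sum_(m < n) Qtail m i *: ('X - 1) ^+ m = \sum_(i.+1 <= l < n.+1) certp l.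
Proof.
have n0 : (0 < n)%N by case: i => i /=; lia.
rewrite big_nat_recr /=; last by have := ltn_ord i; lia.
rewrite certp_root addrC -(big_mkord xpredT (fun m => Qtail m i *: ('X - 1) ^+ m)).
rewrite big_ltn// Qtail0 scale1r expr0; congr (_ + _).
transitivity (\sum_(1 <= m < n) \sum_(l < n | (i < l)%N) Q H m l *: ('X - 1) ^+ m).
  rewrite big_nat [RHS]big_nat; apply: eq_bigr => -[//|m] _.
  by rewrite QtailS scaler_suml.
rewrite exchange_big /= [RHS]big_geq_mkord /=; apply: eq_bigr => l il.
rewrite /certp ltn_eqF// [RHS]big_nat_recr//=.
by rewrite Q_eq0 ?scale0r ?addr0//; lia.
Qed.

(** Removing the first pair of each chain takes out one factor ['X - 1] and leaves the chains summed
    by [Qtail_certp]. *)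
Lemma certp_rec (j : 'I_n) : certp j =
  ('X - 1) * \sum_(i < n | (j <= i)%N) H i j *: \sum_(i.+1 <= l < n.+1) certp l.
Proof.
rewrite {1}/certp ltn_eqF ?ltn_ord// big_add1 /= big_mkord.
under [LHS]eq_bigr => m _ do rewrite QS_ord exprS scaler_suml.
rewrite exchange_big /= mulr_sumr; apply: eq_bigr => i ji.
rewrite -Qtail_certp scaler_sumr mulr_sumr; apply: eq_bigr => m _.
by rewrite -!scalerAr scalerA.
Qed.

End QRecursion.

(** * Certificates as Gram matrix entries *)

Section Certificates.
Variable R : realType.

Lemma coef_XsubC1_exp m i : (('X - 1) ^+ m : {poly R})`_i = (-1) ^+ (m + i) *+ 'C(m, i).
Proof.
rewrite exprBn coef_sum; case: (leqP i m) => im; last first.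
  rewrite bin_small ?mulr0n// big1// => j _.
  rewrite expr1n mulr1 coefMn -polyC1 -polyCN -polyC_exp coefCM coefXn.
  by rewrite (_ : (i == _) = false) ?mulr0 ?mul0rn//; lia.
have mi : (m - i < m.+1)%N by lia.
rewrite (bigD1 (Ordinal mi))//= big1 ?addr0 => [|j].
  rewrite expr1n mulr1 coefMn -polyC1 -polyCN -polyC_exp coefCM coefXn subKn//.
  rewrite eqxx mulr1 bin_sub//; congr (_ *+ _).
  by rewrite /= -[LHS]signr_odd -[RHS]signr_odd oddB// oddD.
rewrite -val_eqE /= => ji.
rewrite expr1n mulr1 coefMn -polyC1 -polyCN -polyC_exp coefCM coefXn.
by rewrite (_ : (i == _) = false) ?mulr0 ?mul0rn//; have := ltn_ord j; lia.
Qed.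

(** The signs of the two i-th coefficients multiply to (-1)^(l + m) for every i, which leaves
    Vandermonde's sum. *)
Lemma ip_XsubC1_exp N l m : (l < N)%N -> (m < N)%N ->
  ip N (('X - 1) ^+ l : {poly R}) (('X - 1) ^+ m) = (-1) ^+ (l + m) * 'C(l + m, m)%:R.
Proof.
move=> lN mN; rewrite -binomial.Vandermonde natr_sum mulr_sumr.
rewrite (big_ord_widen_cond N xpredT (fun j => (-1) ^+ (l + m) * ('C(l, j) * 'C(m, m - j))%:R))//=.
rewrite [RHS]big_mkcond /=; apply: eq_bigr => i _; rewrite !coef_XsubC1_exp.
case: ltnP => im; last by rewrite (bin_small im) mulr0n mulr0.
rewrite bin_sub// -[X in X * _]mulr_natr -[X in _ * X]mulr_natr natrM.
rewrite mulrACA -exprD; congr (_ * _).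
by rewrite -[LHS]signr_odd -[RHS]signr_odd !oddD; case: (odd l); case: (odd m); case: (odd i).
Qed.

(** At the root the polynomial 1 is read as [('X - 1) ^+ 0], so [ip_XsubC1_exp] serves both branches
    of [lambda]. *)
Lemma lambda_ip n (H : 'M[R]_n) (k : 'I_n.+1) (j : 'I_n) :
  lambda (N := n.+1) H k j = - (n.+1%:R * ip n.+1 (certp H k) (certp H j)).
Proof.
rewrite /lambda /= -mulrN; have jn : (j == n :> nat) = false by rewrite ltn_eqF.
rewrite [certp H j]/certp jn /certp; case: ifP => kn; congr (_ * _).
  rewrite ip_sumr -sumrN big_nat [RHS]big_nat; apply: eq_bigr => -[//|m] mn.
  rewrite ipZr -(expr0 ('X - 1)) ip_XsubC1_exp; [|lia|lia].
  by rewrite add0n binn mulr1 exprS mulN1r mulrN opprK mulrC.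
rewrite ip_suml -sumrN exchange_big /= big_nat [RHS]big_nat; apply: eq_bigr => -[//|m] mn.
rewrite ip_sumr -sumrN big_nat [RHS]big_nat; apply: eq_bigr => -[//|l] ln.
rewrite ipZr ipZl ipC ip_XsubC1_exp; [|lia|lia].
have -> : ((l.+1 + m.+1).-1 = l + m.+1)%N by lia.
by rewrite addSn exprS; ring.
Qed.

End Certificates.

(** * Correspondence between H-matrices and polynomial families *)

Section CertpBijection.
Variables (R : realType) (n : nat).
Implicit Types (H : 'M[R]_n) (q : nat -> {poly R}).

Lemma certp_at1 H j : j != n -> (certp H j).[1] = 0.
Proof.
rewrite /certp => /negPf ->; rewrite horner_sum big_nat big1// => -[//|m] _.
by rewrite hornerZ horner_exp hornerD hornerN hornerX hornerC subrr expr0n mulr0.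
Qed.

Lemma size_certp H j : (j <= n)%N -> (size (certp H j) <= n.+1 - j)%N.
Proof.
move=> jn; rewrite /certp; case: eqP => [->|_]; first by rewrite size_poly1; lia.
rewrite big_nat (leq_trans (size_sum _ _ _))//; apply/bigmax_leqP_seq => m _ mn.
case: (leqP (m + j) n) => mj; last by rewrite Q_eq0 ?scale0r ?size_poly0//; lia.
rewrite (leq_trans (size_scale_leq _ _))// -polyC1 size_exp_XsubC; lia.
Qed.

Let tail q i := \sum_(i.+1 <= l < n.+1) q l.

Let size_tail q : (forall j, (j <= n)%N -> size (q j) = (n.+1 - j)%N) ->
  forall i, (i < n)%N -> size (tail q i) = (n - i)%N.
Proof.
move=> qs i iN; have sq : size (q i.+1) = (n - i)%N by rewrite qs.
rewrite /tail big_ltn// size_polyDl sq//.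
rewrite big_nat (leq_ltn_trans (size_sum _ _ _))//.
apply: (@leq_ltn_trans (n - i.+1)%N); last by lia.
by apply/bigmax_leqP_seq => m _ mi; rewrite qs; lia.
Qed.

(** Each [q j] with j < n is divisible by ['X - 1], and its quotient expands in the tail sums, whose
    degrees strictly decrease. The coordinates form column [j] of the matrix, as [certp_rec]
    requires. *)
Lemma certp_surj q : q n = 1 -> (forall j, (j < n)%N -> (q j).[1] = 0) ->
  (forall j, (j <= n)%N -> size (q j) = (n.+1 - j)%N) ->
  exists2 H : 'M[R]_n, is_trig_mx H & forall j, (j <= n)%N -> certp H j = q j.
Proof.
move=> qn q1 qs; have st := size_tail qs.
have /choice[c cE] : forall j : 'I_n, exists c : nat -> R,
    q j = ('X - 1) * \sum_(j <= i < n) c i *: tail q i.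
  move=> j; have /factor_theorem[r qE] : root (q j) 1 by apply/rootP/q1.
  have [c rE] : exists c : nat -> R, r = \sum_(j <= i < n) c i *: tail q i.
    apply: tri_span => [|i ij|]; first by rewrite ltnW.
      by apply: st; lia.
    have sX : size ('X - 1%:P : {poly R}) = 2%N := size_XsubC _.
    have [->|r0] := eqVneq r 0; first by rewrite size_poly0.
    have := qs j (ltnW (ltn_ord j)); rewrite qE size_mul ?polyXsubC_eq0// sX.
    move=> h; apply: (@leq_trans ((size r + 2).-1 - 1)); last by rewrite h; lia.
    by rewrite addn2 /= subn1.
  by exists c; rewrite qE rE polyC1 mulrC.
exists (\matrix_(i, j) if (j <= i)%N then c j i else 0).
  by apply/is_trig_mxP => i j ij; rewrite mxE leqNgt ij.
move=> j; have [d] := ubnP (n - j)%N; elim: d j => // d IH j jd jn.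
have [->|ne] := eqVneq j n; first by rewrite certp_root qn.
have jltn : (j < n)%N by lia.
rewrite (certp_rec _ (Ordinal jltn)) (cE (Ordinal jltn)) big_geq_mkord /=.
congr (_ * _); apply: eq_bigr => i /= ji; rewrite mxE /= ji; congr (_ *: _).
by apply: eq_big_nat => l il; apply: IH; lia.
Qed.

(** By [certp_rec], column [j] holds the coordinates of [certp H j] divided by ['X - 1] in the
    linearly independent tail sums. *)
Lemma certp_inj H H' : is_trig_mx H -> is_trig_mx H' ->
  (forall j, (j <= n)%N -> size (certp H j) = (n.+1 - j)%N) ->
  (forall j, (j <= n)%N -> certp H j = certp H' j) -> H = H'.
Proof.
move=> /is_trig_mxP tH /is_trig_mxP tH' qs qE; have st := size_tail qs.
apply/matrixP => i j; case: (ltnP i j) => [ij|ji]; first by rewrite tH ?tH'.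
pose c m := if insub m is Some o then H o j - H' o j else 0.
apply/eqP; rewrite -subr_eq0; apply/eqP.
have -> : H i j - H' i j = c i by rewrite /c valK.
apply: (@tri_free _ n (tail (certp H)) j) => [m mj||]; [by apply: st; lia| |].
  have X0 : 'X - 1 != 0 :> {poly R} by rewrite -polyC1 polyXsubC_eq0.
  apply: (mulfI X0); rewrite mulr0 big_geq_mkord /=.
  under eq_bigr => m _ do rewrite /c valK scalerBl.
  rewrite sumrB mulrBr -certp_rec.
  apply/eqP; rewrite subr_eq0 qE ?(ltnW (ltn_ord j))// certp_rec; apply/eqP.
  congr (_ * _); apply: eq_bigr => m _; congr (_ *: _).
  by apply: eq_big_nat => l il; rewrite qE//; lia.
by rewrite ji ltn_ord.
Qed.

End CertpBijection.

(** * Euclidean spaces *)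

Section DotTheory.
Variables (R : realType) (U : lmodType R) (dot : {dot U for idfun}).

Lemma dotC x y : dot x y = dot y x.
Proof. by rewrite hermC expr0 mul1r. Qed.

Lemma dotDl x y z : dot (x + y) z = dot x z + dot y z.
Proof. exact: linearDl. Qed.

Lemma dotBl x y z : dot (x - y) z = dot x z - dot y z.
Proof. exact: linearBl. Qed.

Lemma dotZl a x z : dot (a *: x) z = a * dot x z.
Proof. exact: linearZl_LR. Qed.

Lemma dotDr x y z : dot z (x + y) = dot z x + dot z y.
Proof. exact: linearDr. Qed.

Lemma dotBr x y z : dot z (x - y) = dot z x - dot z y.
Proof. exact: linearBr. Qed.

Lemma dotZr a x z : dot z (a *: x) = a * dot z x.
Proof. exact: linearZr_LR. Qed.

Lemma dot_suml I (r : seq I) (P : pred I) (F : I -> U) z :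
  dot (\sum_(i <- r | P i) F i) z = \sum_(i <- r | P i) dot (F i) z.
Proof. exact: linear_sumlz. Qed.

Lemma dot_sumr I (r : seq I) (P : pred I) (F : I -> U) z :
  dot z (\sum_(i <- r | P i) F i) = \sum_(i <- r | P i) dot z (F i).
Proof. exact: linear_sumr. Qed.

Lemma dot_ge0 x : 0 <= dot x x.
Proof.
have [->|x0] := eqVneq x 0; first by have -> : dot 0 0 = 0 by exact: linear0l.
exact/ltW/neq0_dnorm_gt0.
Qed.

(** Expands the squared norm of [dot y y *: x - dot x y *: y]. *)
Lemma dot_cauchy_schwarz x y : dot x y ^+ 2 <= dot x x * dot y y.
Proof.
have [->|y0] := eqVneq y 0.
  have d0 z : dot z 0 = 0 by exact: linear0r.
  by rewrite !d0 mulr0 expr0n.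
have yy0 : 0 < dot y y by exact: neq0_dnorm_gt0.
rewrite -subr_ge0 -(pmulr_rge0 _ yy0).
have := dot_ge0 (dot y y *: x - dot x y *: y).
rewrite dotBl !dotBr !dotZl !dotZr (dotC y x).
by congr (0 <= _); ring.
Qed.

End DotTheory.

(** A separate name for row vectors, which otherwise carry the sup norm, while [Hstar] asks for a
    norm from an inner product. *)
Definition euclid (R : realType) (n : nat) : Type := 'rV[R]_n.
HB.instance Definition _ (R : realType) n := GRing.Lmodule.copy (euclid R n) 'rV[R]_n.

Definition edot (R : realType) n (x y : euclid R n) : R :=
  \sum_i x ord0 i * y ord0 i.

Section Edot.
Variables (R : realType) (n : nat).

Fact edot_zmodl (y : euclid R n) : zmod_morphism (@edot R n ^~ y).
Proof.
move=> u v; rewrite /edot -sumrB; apply: eq_bigr => i _.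
by rewrite !mxE mulrBl.
Qed.
Fact edot_zmodr (y : euclid R n) : zmod_morphism (@edot R n y).
Proof.
move=> u v; rewrite /edot -sumrB; apply: eq_bigr => i _.
by rewrite !mxE mulrBr.
Qed.
Fact edot_scalel (y : euclid R n) : scalable_for *%R (@edot R n ^~ y).
Proof.
move=> a u; rewrite /edot mulr_sumr; apply: eq_bigr => i _.
by rewrite !mxE mulrA.
Qed.
Fact edot_scaler (y : euclid R n) : scalable_for (idfun \; *%R) (@edot R n y).
Proof.
move=> a u; rewrite /edot /= mulr_sumr; apply: eq_bigr => i _.
by rewrite !mxE mulrCA.
Qed.
HB.instance Definition _ := @isBilinear.Build R (euclid R n) (euclid R n) R
  *%R (idfun \; *%R) (@edot R n) edot_zmodl edot_zmodr edot_scalel edot_scaler.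

Fact edot_herm (x y : euclid R n) : edot x y = (-1) ^+ false * idfun (edot y x).
Proof. by rewrite expr0 mul1r; apply: eq_bigr => i _; rewrite mulrC. Qed.
HB.instance Definition _ := @isHermitianSesquilinear.Build R (euclid R n) false
  idfun (@edot R n) edot_herm.

Fact edot_gt0 (x : euclid R n) : x != 0 -> 0 < edot x x.
Proof.
move=> x0; rewrite lt_def sumr_ge0 ?andbT; last by move=> i _; rewrite -expr2 sqr_ge0.
apply: contra x0; rewrite psumr_eq0; last by move=> i _; rewrite -expr2 sqr_ge0.
move=> /allP x0; apply/eqP/rowP => i; rewrite mxE.
have := x0 i (mem_index_enum _); rewrite /= -expr2 sqrf_eq0 => /eqP.
by [].
Qed.
HB.instance Definition _ := @isDotProduct.Build R (euclid R n) (@edot R n) edot_gt0.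

Definition enorm (x : euclid R n) : R := Num.sqrt (edot x x).

Lemma edot_ge0 (x : euclid R n) : 0 <= edot x x.
Proof. exact: (@dot_ge0 _ _ (@edot R n : {dot (euclid R n) for idfun})). Qed.

Lemma enorm_triangle x y : enorm (x + y) <= enorm x + enorm y.
Proof.
pose d := (@edot R n : {dot (euclid R n) for idfun}).
rewrite /enorm -(ler_pXn2r (n := 2)) ?nnegrE ?addr_ge0 ?sqrtr_ge0//.
rewrite sqrrD !sqr_sqrtr ?edot_ge0//.
have -> : edot (x + y) (x + y) = edot x x + 2 * edot x y + edot y y.
  by rewrite -[LHS]/(d (x + y) (x + y)) dotDl !dotDr (dotC d y x) /d /=; ring.
rewrite lerD2r lerD2l -[leRHS]mulr_natl ler_pM2l//.
apply: le_trans (ler_norm _) _; rewrite -sqrtr_sqr -sqrtrM ?edot_ge0//.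
by rewrite ler_wsqrtr// (dot_cauchy_schwarz d).
Qed.

Lemma enormZ a x : enorm (a *: x) = `|a| * enorm x.
Proof.
pose d := (@edot R n : {dot (euclid R n) for idfun}).
rewrite /enorm -sqrtr_sqr -sqrtrM ?sqr_ge0//; congr Num.sqrt.
by rewrite -[LHS]/(d (a *: x) (a *: x)) dotZl dotZr mulrA.
Qed.

Lemma enorm_eq0 x : enorm x = 0 -> x = 0.
Proof.
move=> /eqP; rewrite sqrtr_eq0 => xx; apply: contraTeq xx => /edot_gt0.
by rewrite ltNge.
Qed.

HB.instance Definition _ := Lmodule_isNormed.Build R (euclid R n)
  enorm_triangle enormZ enorm_eq0.

Lemma euclid_sqr_norm (x : euclid R n) : `|x| ^+ 2 = edot x x.
Proof. by rewrite sqr_sqrtr ?edot_ge0. Qed.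

Lemma euclid_coord_le (x : euclid R n) i : `|x ord0 i| <= `|x|.
Proof.
rewrite -sqrtr_sqr ler_wsqrtr// /edot (bigD1 i)//= -expr2 lerDl.
by apply: sumr_ge0 => j _; rewrite -expr2 sqr_ge0.
Qed.

Lemma euclid_norm_le_sum (x : euclid R n) : `|x| <= \sum_i `|x ord0 i|.
Proof.
rewrite {1}(row_sum_delta x); apply: le_trans (ler_norm_sum _ _ _) _.
apply: ler_sum => i _; rewrite normrZ ler_piMr//.
rewrite -[leLHS]/(Num.sqrt _) -(sqrtr1) ler_wsqrtr// /edot (bigD1 i)//= big1.
  by rewrite !mxE !eqxx mulr1 addr0.
by move=> j ji; rewrite !mxE (negPf ji) andbF mul0r.
Qed.

Local Open Scope classical_set_scope.

Lemma euclid_complete (F : set_system (euclid R n)) :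
  ProperFilter F -> cauchy F -> cvg F.
Proof.
move=> FF /cauchy_ballP Fc.
have cvgi i : cvg ((fun x : euclid R n => x ord0 i) @ F).
  apply: R_complete; apply/cauchy_ballP => e e0 /=.
  have := Fc e e0; rewrite !near_simpl; apply: filterS => -[x y] /=.
  rewrite -!ball_normE /=; apply: le_lt_trans.
  by have := euclid_coord_le (x - y) i; rewrite !mxE.
pose l : euclid R n := \row_i lim ((fun x : euclid R n => x ord0 i) @ F).
apply/cvg_ex; exists l; apply/cvgrPdist_lt => e e0.
(* Dividing by n + 1 rather than n covers n = 0 and keeps the sum of the n bounds strictly below
   [e]. *)
have nearF : F [set x | forall i, `|l ord0 i - x ord0 i| < e / n.+1%:R].
  pose P (i : 'I_n) (x : euclid R n) := `|l ord0 i - x ord0 i| < e / n.+1%:R.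
  suff : forall i, \forall x \near F, P i x by move=> /filter_forall.
  move=> i.
  have := cvgi i; move=> /cvgrPdist_lt /(_ (e / n.+1%:R)).
  by rewrite divr_gt0// /P mxE => /(_ isT).
apply: filterS nearF => x lx; apply: le_lt_trans (euclid_norm_le_sum _) _.
apply: (@le_lt_trans _ _ (\sum_(i < n) e / n.+1%:R)).
  by apply: ler_sum => i _; apply/ltW; have := lx i; rewrite /= !mxE.
rewrite sumr_const card_ord -[ltLHS]mulr_natr -mulrA gtr_pMr//.
by rewrite mulrC ltr_pdivrMr// mul1r ltr_nat.
Qed.

HB.instance Definition _ := Uniform_isComplete.Build (euclid R n) euclid_complete.

End Edot.

(** * Sufficiency of the certificates *)

Lemma generates_sum (R : realType) (X : normedModType R) n (H : 'M[R]_n)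
    (T : X -> X) (y0 : X) (y : nat -> X) (k : nat) :
  generates (N := n.+1) H T y0 y -> (k <= n)%N ->
  y k = y0 - \sum_(i < n | (i < k)%N) \sum_(l < n | (l <= i)%N) H i l *: (y l - T (y l)).
Proof.
case=> y00 yS; elim: k => [|k IH] kn.
  by rewrite big_pred0 ?subr0 // => i; rewrite ltn0.
rewrite (yS (Ordinal kn)) IH 1?ltnW//= -addrA -opprD; congr (_ - _).
rewrite [RHS](bigD1 (Ordinal kn)) //= addrC; congr (_ + _).
apply: eq_bigl => i; rewrite -val_eqE /=; lia.
Qed.

(** Row [i] of [H] enters exactly the iterates after [i], hence the tail sums. By [certp_rec], the
    polynomial attached to [g l] is [certp H l] divided by ['X - 1]. *)
Lemma certp_tail_sum (R : realType) (X : lmodType R) n (H : 'M[R]_n) (g y : nat -> X) (y0 : X) :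
  (forall k, (k <= n)%N ->
    y k = y0 - \sum_(i < n | (i < k)%N) \sum_(l < n | (l <= i)%N) H i l *: g l) ->
  forall c, \sum_(j < n.+1) (certp H j)`_c *: y j =
    (\sum_(0 <= j < n.+1) certp H j)`_c *: y0 -
    \sum_(l < n) (\sum_(i < n | (l <= i)%N) H i l *: \sum_(i.+1 <= l < n.+1) certp H l)`_c *: g l.
Proof.
move=> yE c; rewrite big_mkord coef_sum scaler_suml.
under eq_bigr => j _ do rewrite yE ?leq_ord// scalerBr.
rewrite sumrB; congr (_ - _).
under eq_bigr => j _ do rewrite scaler_sumr.
rewrite (exchange_big_dep xpredT) //=.
under [RHS]eq_bigr => l _ do rewrite coef_sum scaler_suml.
rewrite [RHS](exchange_big_dep xpredT) //=; apply: eq_bigr => i _.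
rewrite -scaler_suml scaler_sumr; apply: eq_bigr => l li.
rewrite coefZ scalerA mulrC -coef_sum; congr (_ *: _); congr (_ * _).
by rewrite big_geq_mkord.
Qed.

(* Completing squares: [Gam c + bet c] is a shift of [bet c]. *)
Lemma shifted_squares (R : realType) (X : lmodType R) (dot : {dot X for idfun})
    n (Gam bet : nat -> X) (gn : X) :
  Gam 0%N = gn - bet 0%N -> (forall c, Gam c.+1 = bet c - bet c.+1) -> bet n = 0 ->
  \sum_(c < n.+1) dot (Gam c) (Gam c) + 2 * \sum_(c < n.+1) dot (Gam c) (bet c)
    = dot gn gn.
Proof.
move=> G0 GS bn; rewrite mulr_sumr -big_split /=.
transitivity (\sum_(c < n.+1) (dot (Gam c + bet c) (Gam c + bet c) - dot (bet c) (bet c))).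
  by apply: eq_bigr => c _; rewrite dotDl !dotDr (dotC _ (bet c) (Gam c)); ring.
rewrite sumrB big_ord_recl [X in _ - X]big_ord_recr /= bn.
have -> : dot 0 0 = 0 by exact: linear0l.
rewrite addr0 G0 subrK -[RHS]addr0 -addrA; congr (_ + _).
by apply/eqP; rewrite subr_eq0; apply/eqP/eq_bigr => c _; rewrite GS subrK.
Qed.

(** Polarised quadratic form of the Laplacian with weights -G; the row sums [d] are the
    grounding. *)
Lemma laplacian_form (R : realType) (X : lmodType R) (dot : {dot X for idfun})
    n (G : nat -> nat -> R) (d : nat -> R) (a b : nat -> X) :
  (forall j l, G j l = G l j) ->
  (forall j, (j < n)%N -> \sum_(l < n) G j l = d j) ->
  \sum_(j < n) \sum_(l < n) G j l * dot (a j - a l) (b j - b l) =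
  2 * \sum_(j < n) d j * dot (a j) (b j) -
  2 * \sum_(j < n) \sum_(l < n) G j l * dot (a j) (b l).
Proof.
move=> GC Gd.
transitivity (\sum_(j < n) \sum_(l < n)
   ((G j l * dot (a j) (b j) + G j l * dot (a l) (b l)) -
    (G j l * dot (a j) (b l) + G j l * dot (a l) (b j)))).
  by apply: eq_bigr => j _; apply: eq_bigr => l _; rewrite dotBl !dotBr; ring.
under eq_bigr => j _ do rewrite sumrB !big_split /=.
rewrite sumrB !big_split /=.
have e1 : \sum_(j < n) \sum_(l < n) G j l * dot (a j) (b j) = \sum_(j < n) d j * dot (a j) (b j).
  by apply: eq_bigr => j _; rewrite -mulr_suml Gd.
have e2 : \sum_(j < n) \sum_(l < n) G j l * dot (a l) (b l) = \sum_(j < n) d j * dot (a j) (b j).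
  rewrite exchange_big -e1 /=; apply: eq_bigr => j _; apply: eq_bigr => l _.
  by rewrite GC.
have e3 : \sum_(j < n) \sum_(l < n) G j l * dot (a l) (b j) =
    \sum_(j < n) \sum_(l < n) G j l * dot (a j) (b l).
  by rewrite exchange_big /=; apply: eq_bigr => j _; apply: eq_bigr => l _; rewrite GC.
by rewrite e1 e2 e3; ring.
Qed.

(** Passes from the double sums of [laplacian_form] to the sums over coefficients of
    [shifted_squares]. *)
Lemma gram_form (R : realType) (X : lmodType R) (dot : {dot X for idfun})
    n m (q : nat -> {poly R}) (a b : nat -> X) :
  \sum_(j < m) \sum_(l < m) ip n (q j) (q l) * dot (a j) (b l) =
  \sum_(c < n) dot (\sum_(j < m) (q j)`_c *: a j) (\sum_(l < m) (q l)`_c *: b l).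
Proof.
under [RHS]eq_bigr => c _ do rewrite dot_suml.
rewrite [RHS]exchange_big /=; apply: eq_bigr => j _.
under [RHS]eq_bigr => c _ do rewrite dot_sumr.
rewrite [RHS]exchange_big /=; apply: eq_bigr => l _.
by rewrite mulr_suml; apply: eq_bigr => c _; rewrite dotZl dotZr mulrA.
Qed.

Lemma Hstar_of_certificates (R : realType) n (H : 'M[R]_n) :
  is_trig_mx H ->
  \sum_(0 <= j < n.+1) certp H j = n.+1%:R^-1 *: ones R n.+1 ->
  (forall j l, (j < l <= n)%N -> ip n.+1 (certp H l) (certp H j) <= 0) ->
  Hstar (N := n.+1) H.
Proof.
move=> trigH sumq qneg; split; first exact: trigH.
move=> X dot nd T ystar y0 y nT fT gen /=.
pose g j := y j - T (y j); set N : R := n.+1%:R.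
have N0 : 0 < N by rewrite ltr0n.
(* Nonexpansiveness of [T] restated as cocoercivity of the residual map. *)
have monot a b : let u := a - T a in let v := b - T b in
    dot (u - v) (u - v) <= 2 * dot (u - v) (a - b).
  move=> u v; have : `|T a - T b| ^+ 2 <= `|a - b| ^+ 2.
    by rewrite ler_pXn2r ?nnegrE// nT.
  rewrite !nd.
  have -> : T a - T b = (a - b) - (u - v).
    by rewrite opprD addrACA -[X in _ = _ + X]opprD !subKr.
  rewrite (dotBl _ (a - b)) !(dotBr _ (a - b) (u - v)) (dotC _ (a - b) (u - v)).
  by move: (dot _ _) (dot _ _) (dot _ _) => x1 x2 x3; lra.
pose q := certp H.
pose G j l := ip n.+1 (q j) (q l).
have GC j l : G j l = G l j by rewrite /G ipC.
have qs j : (j <= n)%N -> (size (q j) <= n.+1)%N.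
  by move=> jn; apply: (leq_trans (size_certp _ jn)); lia.
(* By the sum condition a row sum is a value at 1 over N, so only the root row is grounded. *)
have Gd j : (j < n.+1)%N -> \sum_(l < n.+1) G j l = N^-1 * (j == n)%:R.
  move=> jn; rewrite -(big_mkord xpredT (fun l => ip n.+1 (q j) (q l))) -ip_sumr.
  rewrite sumq ipZr ip_ones ?qs//; congr (_ * _).
  by rewrite /q; have [->|ne] := eqVneq j n; [rewrite certp_root hornerC|rewrite certp_at1].
have sumd (F : nat -> R) : \sum_(j < n.+1) N^-1 * (j == n :> nat)%:R * F j = N^-1 * F n.
  rewrite big_ord_recr /= eqxx mulr1 big1 ?add0r// => i _.
  by rewrite ltn_eqF// mulr0 mul0r.
pose Gam c := \sum_(j < n.+1) (q j)`_c *: g j.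
(* [B l] is the quotient of [q l] by ['X - 1]; the inner sum only extends column [l] of [H] to
   natural indices. *)
pose B l := \sum_(i < n | (l <= i)%N)
  (\sum_(l' < n | l' == l :> nat) H i l') *: \sum_(i.+1 <= l < n.+1) q l.
have BE (l : 'I_n) : B l = \sum_(i < n | (l <= i)%N) H i l *: \sum_(i.+1 <= l < n.+1) q l.
  by apply: eq_bigr => i _; rewrite (big_pred1 l)// => l'; rewrite -val_eqE.
pose bet c := \sum_(l < n) (B l)`_c *: g l.
have yE c : (c < n.+1)%N -> \sum_(j < n.+1) (q j)`_c *: y j = N^-1 *: y0 - bet c.
  move=> cn; rewrite (certp_tail_sum (g := g) (y0 := y0)) => [|k kn]; last first.
    exact: generates_sum gen kn.
  congr (_ - _).
    by rewrite sumq coefZ coef_ones cn mulr1.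
  by apply: eq_bigr => l _; rewrite BE.
have qB (l : 'I_n) : q l = ('X - 1) * B l by rewrite BE /q certp_rec.
have qcoef0 (l : 'I_n) : (q l)`_0 = - (B l)`_0.
  by rewrite qB mulrBl mul1r coefB coefXM /= sub0r.
have qcoefS (l : 'I_n) c : (q l)`_c.+1 = (B l)`_c - (B l)`_c.+1.
  by rewrite qB mulrBl mul1r coefB coefXM /=.
have Gam0 : Gam 0%N = g n - bet 0%N.
  rewrite /Gam big_ord_recr /= /q certp_root coef1 scale1r addrC; congr (_ + _).
  by rewrite -sumrN; apply: eq_bigr => l _; rewrite -/q qcoef0 scaleNr.
have GamS c : Gam c.+1 = bet c - bet c.+1.
  rewrite /Gam big_ord_recr /= /q certp_root coef1 scale0r addr0.
  by rewrite -sumrB; apply: eq_bigr => l _; rewrite -/q qcoefS scalerBl.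
have betn : bet n = 0.
  rewrite /bet big1// => l _; rewrite nth_default ?scale0r//.
  rewrite /B (leq_trans (size_sum _ _ _))//; apply/bigmax_leqP => i li.
  rewrite (leq_trans (size_scale_leq _ _))// big_nat (leq_trans (size_sum _ _ _))//.
  apply/bigmax_leqP_seq => m _ mi; apply: (leq_trans (size_certp _ _)); lia.
have sq := shifted_squares dot Gam0 GamS betn.
have sumGam : \sum_(c < n.+1) Gam c = g n.
  rewrite exchange_big /= big_ord_recr /= big1 ?add0r => [|l _]; last first.
    rewrite -scaler_suml; have -> : \sum_(c < n.+1) (q l)`_c = (q l).[1].
      rewrite (horner_coef_wide _ (qs l _)) ?(ltnW (ltn_ord l))//.
      by apply: eq_bigr => c _; rewrite expr1n mulr1.
    by rewrite /q certp_at1 ?scale0r ?ltn_eqF.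
  rewrite /q certp_root big_ord_recl /= coef1 scale1r big1 ?addr0// => c _.
  by rewrite coef1 scale0r.
have EE : \sum_(j < n.+1) \sum_(l < n.+1) G j l * dot (g j) (y l) =
    N^-1 * dot (g n) y0 - \sum_(c < n.+1) dot (Gam c) (bet c).
  rewrite /G gram_form -sumGam dot_suml mulr_sumr -sumrB; apply: eq_bigr => c _.
  by rewrite yE// dotBr dotZr.
have FE : \sum_(j < n.+1) \sum_(l < n.+1) G j l * dot (g j) (g l) =
    \sum_(c < n.+1) dot (Gam c) (Gam c) by rewrite /G gram_form.
have /= L1 := laplacian_form dot g y GC Gd; rewrite (sumd (fun j => dot (g j) (y j))) EE in L1.
have /= L2 := laplacian_form dot g g GC Gd; rewrite (sumd (fun j => dot (g j) (g j))) FE in L2.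
(* Weighted sum of the inequalities between iterates; the reversed direction comes from the
   nonpositive [G j l]. *)
have le : \sum_(j < n.+1) \sum_(l < n.+1) G j l * dot (g j - g l) (y j - y l) <=
    2^-1 * \sum_(j < n.+1) \sum_(l < n.+1) G j l * dot (g j - g l) (g j - g l).
  rewrite mulr_sumr ler_sum// => j _; rewrite mulr_sumr ler_sum// => l _.
  have [->|jl] := eqVneq j l.
    by have -> : dot (g l - g l) (y l - y l) = 0; rewrite subrr;
       [exact: linear0l|have -> : dot 0 0 = 0 by exact: linear0l]; rewrite !mulr0.
  have Gle0 : G j l <= 0.
    case: (ltngtP j l) => [h|h|/val_inj h]; last by rewrite h eqxx in jl.
      by rewrite GC qneg// h leq_ord.
    by rewrite qneg// h leq_ord.
  rewrite mulrCA ler_wnM2l//.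
  by have := monot (y j) (y l); rewrite -/(g j) -/(g l) /= => h; lra.
have star : dot (g n) (g n) <= 2 * dot (g n) (y n - ystar).
  by have := monot (y n) ystar; rewrite /= fT subrr subr0.
have main : N * dot (g n) (g n) <= 2 * dot (g n) (y0 - ystar).
  move: le star sq; rewrite L1 L2 (dotBr _ (y n) ystar) (dotBr _ y0 ystar).
  move: (dot (g n) (y n)) (dot (g n) y0) (dot (g n) ystar) (dot (g n) (g n)).
  move: (\sum_(c < _) dot (Gam c) (Gam c)) (\sum_(c < _) dot (Gam c) (bet c)).
  move=> S1 S2 u v w gg le star sq.
  have : gg <= N^-1 * (gg + 2 * v - 2 * u).
    by clear -le sq; move: (N^-1) le => iN le; lra.
  by move/(ler_wpM2l (ltW N0)); rewrite mulVKf ?gt_eqF// => h; lra.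
rewrite ler_pdivlMr ?exprn_gt0// !nd -/N -/(g n).
have [->|gn0] := eqVneq (dot (g n) (g n)) 0.
  by rewrite mul0r mulr_ge0// dot_ge0.
have gpos : 0 < dot (g n) (g n) by rewrite lt_def gn0 dot_ge0.
have cs := dot_cauchy_schwarz dot (g n) (y0 - ystar).
(* Squaring [main] and applying Cauchy-Schwarz gives the bound multiplied by [dot (g n) (g n)]. *)
rewrite -(ler_pM2l gpos); apply: le_trans (_ : (N * dot (g n) (g n)) ^+ 2 <= _).
  by rewrite exprMn; lra.
apply: (@le_trans _ _ ((2 * dot (g n) (y0 - ystar)) ^+ 2)); last by rewrite exprMn; lra.
have Ng0 : 0 <= N * dot (g n) (g n) by rewrite mulr_ge0// ltW.
by rewrite ler_pXn2r ?nnegrE//; exact: le_trans main.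
Qed.

(** * Necessity of the sum condition *)

(** Each new value depends on the whole history, so every stage carries a function that is correct
    up to its index; the diagonal is the sequence. *)
Lemma memory_recursion (R : nzRingType) (X : lmodType R) n (H : 'M[R]_n)
    (F : X -> X) (x0 : X) :
  exists z : nat -> X, z 0%N = x0 /\ forall k : 'I_n,
    z k.+1 = z k - \sum_(j < n | (j <= k)%N) H k j *: F (z j).
Proof.
pose step k (z : nat -> X) m := if (m <= k)%N then z m else
  if insub k is Some o then z k - \sum_(j < n | (j <= k)%N) H o j *: F (z j) else z k.
pose Z := fix Z k := if k is k'.+1 then step k' (Z k') else fun=> x0.
have ZE m k : (m <= k)%N -> Z k m = Z m m.
  elim: k => [|k IH]; first by rewrite leqn0 => /eqP ->.
  by rewrite leq_eqVlt => /orP[/eqP -> //|mk]; rewrite /= /step -ltnS mk IH.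
exists (fun k => Z k k); split=> // k; rewrite /= {1}/step ltnn valK.
by congr (_ - _); apply: eq_bigr => j jk; rewrite ZE.
Qed.

(** [P] is the algorithm run on polynomials from 1, with multiplication by ['X] as operator.
    Unrolling [P] in the sum of all [certp H j * P j] returns its terms with j < n plus the sum of
    all [certp H j]; cancelling leaves [P n]. *)
Lemma certp_duality (R : realType) n (H : 'M[R]_n) (P : nat -> {poly R}) :
  P 0%N = 1 ->
  (forall k : 'I_n, P k.+1 =
    P k - \sum_(j < n | (j <= k)%N) H k j *: ((1 - 'X) * P j)) ->
  P n = \sum_(0 <= j < n.+1) certp H j.
Proof.
move=> P0 PS.
have PE k : (k <= n)%N -> P k =
    1 + ('X - 1) * \sum_(i < n | (i < k)%N) \sum_(l < n | (l <= i)%N) H i l *: P l.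
  elim: k => [|k IH] kn; first by rewrite big_pred0 ?mulr0 ?addr0// => i; rewrite ltn0.
  rewrite (PS (Ordinal kn)) IH 1?ltnW//= -addrA; congr (_ + _).
  rewrite [in RHS](bigD1 (Ordinal kn)) //= mulrDr addrC; congr (_ + _).
    rewrite -sumrN mulr_sumr; apply: eq_bigr => j _.
    by rewrite -scalerN -mulNr opprB -scalerAr.
  by congr (_ * _); apply: eq_bigl => i; rewrite -val_eqE /=; lia.
have e : \sum_(j < n.+1) certp H j * P j =
    \sum_(j < n.+1) certp H j + \sum_(l < n) certp H l * P l.
  under eq_bigr => j _ do rewrite PE ?leq_ord// mulrDr mulr1.
  rewrite big_split /=; congr (_ + _).
  under [RHS]eq_bigr => l _ do rewrite certp_rec -mulrA mulr_suml.
  rewrite -mulr_sumr (exchange_big_dep xpredT) //=.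
  under eq_bigr => j _ do rewrite mulrCA.
  rewrite -mulr_sumr; congr (_ * _).
  under [LHS]eq_bigr => j _ do rewrite mulr_sumr.
  rewrite (exchange_big_dep xpredT) //=; apply: eq_bigr => i _.
  rewrite -mulr_suml mulr_sumr; apply: eq_bigr => l li.
  by rewrite -scalerAl -scalerAr big_geq_mkord.
move: e; rewrite big_ord_recr /= certp_root mul1r addrC.
by move/addIr => ->; rewrite big_mkord.
Qed.

(** * The negacyclic shift as a worst-case isometry *)

Section NegacyclicShift.
Variables (R : realType) (n : nat).
Local Notation E := (euclid R n.+1).

(** Multiplication by ['X] modulo ['X^n.+1 + 1] on coefficient rows. *)
Definition negashift (x : E) : E :=
  \row_j (if j == ord0 then - x ord0 ord_max else x ord0 (inord j.-1)).

Definition coef_row (p : {poly R}) : E := \row_i p`_i.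

Lemma negashiftB x y : negashift (x - y) = negashift x - negashift y.
Proof. by apply/rowP => j; rewrite !mxE; case: ifP; rewrite ?opprD. Qed.

Lemma negashiftZ a x : negashift (a *: x) = a *: negashift x.
Proof. by apply/rowP => j; rewrite !mxE; case: ifP; rewrite ?mulrN. Qed.

Lemma negashift0 : negashift 0 = 0.
Proof. by have := negashiftB 0 0; rewrite !subrr. Qed.

Lemma negashiftD x y : negashift (x + y) = negashift x + negashift y.
Proof.
by have := negashiftB (x + y) y; rewrite addrK => ->; rewrite subrK.
Qed.

Lemma negashift_norm x : `|negashift x| = `|x|.
Proof.
congr Num.sqrt; rewrite /edot big_ord_recl [RHS]big_ord_recr /= [RHS]addrC.
congr (_ + _); first by rewrite !mxE eqxx mulrNN.
apply: eq_bigr => i _; rewrite !mxE /=.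
by have -> : inord i = widen_ord (leqnSn n) i by apply: val_inj; rewrite /= inordK// ltnS ltnW.
Qed.

(** The coefficient of degree n is zero, so nothing wraps around. *)
Lemma negashift_coef (p : {poly R}) : (size p <= n)%N -> negashift (coef_row p) = coef_row ('X * p).
Proof.
move=> sp; apply/rowP => j; rewrite !mxE coefXM -val_eqE /=.
case: eqP => j0; first by rewrite nth_default ?oppr0.
by rewrite inordK//; have := ltn_ord j; lia.
Qed.

End NegacyclicShift.

Lemma certp_sum_of_Hstar (R : realType) n (H : 'M[R]_n) : Hstar (N := n.+1) H ->
  \sum_(0 <= j < n.+1) certp H j = n.+1%:R^-1 *: ones R n.+1.
Proof.
case=> _ HS; set t := \sum_(0 <= j < n.+1) _.
pose T := @negashift R n; pose one : euclid R n.+1 := const_mx 1.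
have [y [y0 yS]] := memory_recursion H (fun x => x - T x) one.
have [P [P0 PS]] := memory_recursion H (fun p : {poly R} => (1 - 'X) * p) 1.
have tE : P n = t by exact: certp_duality.
have phiB p r : coef_row n (p - r) = coef_row n p - coef_row n r.
  by apply/rowP => i; rewrite !mxE coefB.
have phiZ a p : coef_row n (a *: p) = a *: coef_row n p.
  by apply/rowP => i; rewrite !mxE coefZ.
have phi_sum I (r : seq I) (Q : pred I) (F : I -> {poly R}) :
    coef_row n (\sum_(i <- r | Q i) F i) = \sum_(i <- r | Q i) coef_row n (F i).
  by apply/rowP => i; rewrite !mxE coef_sum summxE; apply: eq_bigr => l _; rewrite mxE.
have T_sum I (r : seq I) (Q : pred I) (F : I -> euclid R n.+1) :
    T (\sum_(i <- r | Q i) F i) = \sum_(i <- r | Q i) T (F i).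
  by apply: big_morph; [exact: negashiftD|exact: negashift0].
have g0 : y 0%N - T (y 0%N) = 2 *: coef_row n (P 0%N).
  rewrite y0 P0; apply/rowP => j; rewrite !mxE coef1 -val_eqE /=.
  by case: eqP => _; [rewrite opprK mulr1|rewrite mulr0 subrr].
(* The size bound travels with the residual formula: it keeps the earlier [P j] below the wraparound
   of the shift. *)
have gP k : (k <= n)%N -> (size (P k) <= k.+1)%N /\ y k - T (y k) = 2 *: coef_row n (P k).
  elim/ltn_ind: k => -[|k] IH kn.
    by split=> //; rewrite P0 size_poly1.
  have [sk gk] := IH k (ltnSn k) (ltnW kn); split.
    rewrite (PS (Ordinal kn)) /= (leq_trans (size_polyD _ _))// geq_max.
    rewrite (leq_trans sk) ?leqnSn//= size_polyN (leq_trans (size_sum _ _ _))//.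
    apply/bigmax_leqP => j jk; rewrite (leq_trans (size_scale_leq _ _))//.
    have [|sj _] := IH j _ (ltnW (ltn_ord j)); first by rewrite ltnS.
    rewrite -opprB -polyC1 mulNr size_polyN.
    have [->|Pj0] := eqVneq (P j) 0; first by rewrite mulr0 size_poly0.
    have sX : size ('X - 1%:P : {poly R}) = 2%N := size_XsubC _.
    by rewrite (leq_trans (size_polyMleq _ _))// sX add2n /= ltnS (leq_trans sj).
  rewrite (yS (Ordinal kn)) (PS (Ordinal kn)) /= /T negashiftB -/T.
  rewrite opprD addrACA -[X in _ + X]opprD gk phiB scalerBr; congr (_ - _).
  rewrite T_sum -sumrB phi_sum scaler_sumr; apply: eq_bigr => j jk.
  have [|sj gj] := IH j _ (ltnW (ltn_ord j)); first by rewrite ltnS.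
  rewrite /T negashiftZ -/T -scalerBr gj /T negashiftZ negashift_coef; last first.
    by apply: leq_trans sj _; apply: ltn_ord.
  by rewrite -scalerBr -phiB mulrBl mul1r phiZ !scalerA mulrC.
have [] := gP n (leqnn n); rewrite tE => st gn.
have nT : nonexpansive T.
  by move=> u v; rewrite -negashiftB negashift_norm.
have T0 : T 0 = 0 by exact: negashift0.
have gen : generates (N := n.+1) H T one y by split.
have := HS (euclid R n.+1) (@edot R n.+1) (@euclid_sqr_norm R n.+1) T 0 one y nT T0 gen.
rewrite /= gn !euclid_sqr_norm subr0 /edot.
under eq_bigr => i _ do rewrite !mxE.
under [X in _ <= 4 * X / _]eq_bigr => i _ do rewrite !mxE mulr1.
rewrite sumr_const card_ord => le.
have N0 : 0 < n.+1%:R :> R by rewrite ltr0n.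
have NV : n.+1%:R * n.+1%:R^-1 = 1 :> R by rewrite divff// gt_eqF.
have t1 : \sum_(i < n.+1) t`_i = 1.
  transitivity t.[1].
    rewrite (horner_coef_wide _ st).
    by apply: eq_bigr => i _; rewrite expr1n mulr1.
  rewrite /t horner_sum big_nat_recr//= big_nat big1 ?add0r => [|j jn].
    by rewrite certp_root hornerC.
  by rewrite certp_at1//; lia.
have le2 : \sum_(i < n.+1) t`_i ^+ 2 <= n.+1%:R^-1.
  have e : \sum_(i < n.+1) 2 * t`_i * (2 * t`_i) = 4 * \sum_(i < n.+1) t`_i ^+ 2.
    by rewrite mulr_sumr; apply: eq_bigr => i _; ring.
  move: le; rewrite e; set s := \sum_(_ < _) _; move: N0 NV.
  set N : R := n.+1%:R; move: (N) s => M s M0 MV le.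
  have : 4 * s <= 4 * M^-1 by rewrite (le_trans le)// expr2 invfM !mulrA mulfK ?gt_eqF.
  by rewrite ler_pM2l.
(* This variance is the sum of squares minus 1 / N, because the coefficients add up to 1; hence all
   of them equal 1 / N. *)
have s0 : \sum_(i < n.+1) (t`_i - n.+1%:R^-1) ^+ 2 <= 0.
  have -> : \sum_(i < n.+1) (t`_i - n.+1%:R^-1) ^+ 2 =
      \sum_(i < n.+1) t`_i ^+ 2 - 2 * n.+1%:R^-1 * \sum_(i < n.+1) t`_i +
      n.+1%:R^-1 ^+ 2 * n.+1%:R.
    rewrite mulr_sumr -sumrB mulr_natr -[X in _ + _ *+ X](card_ord n.+1) -sumr_const.
    by rewrite -big_split /=; apply: eq_bigr => i _; ring.
  rewrite t1 expr2 divfK ?gt_eqF//; move: (n.+1%:R^-1) (\sum_(_ < _) _) le2 => M s le2.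
  by lra.
have tc i : (i < n.+1)%N -> t`_i = n.+1%:R^-1.
  move=> iN; apply/eqP; rewrite -subr_eq0 -sqrf_eq0.
  move: s0; rewrite le_eqVlt ltNge sumr_ge0 ?orbF => [|j _]; last exact: sqr_ge0.
  rewrite psumr_eq0 => [/allP h|j _]; last exact: sqr_ge0.
  by have := h (Ordinal iN) (mem_index_enum _).
apply/polyP => i; rewrite coefZ coef_ones; case: ltnP => iN.
  by rewrite tc ?mulr1.
by rewrite nth_default ?(leq_trans st)// mulr0.
Qed.

(** * Existence and uniqueness *)

Lemma lambda_gt0 (R : realType) n (H : 'M[R]_n) (k : 'I_n.+1) (j : 'I_n) :
  (0 < lambda (N := n.+1) H k j) = (ip n.+1 (certp H k) (certp H j) < 0).
Proof. by rewrite lambda_ip oppr_gt0 pmulr_rlt0 ?ltr0n. Qed.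

Lemma lambda_eq0 (R : realType) n (H : 'M[R]_n) (k : 'I_n.+1) (j : 'I_n) :
  (lambda (N := n.+1) H k j == 0) = (ip n.+1 (certp H k) (certp H j) == 0).
Proof. by rewrite lambda_ip oppr_eq0 mulf_eq0 pnatr_eq0. Qed.

Theorem theorem1 (R : realType) (N : nat) (hN : (1 <= N)%N)
    (k : 'I_N.-1 -> 'I_N) (hk : forall j : 'I_N.-1, (j < k j)%N) :
  exists! H : 'M[R]_N.-1,
    optimal_vertex H /\
    forall j : 'I_N.-1,
      0 < lambda H (k j) j /\
      forall l : 'I_N, l != k j -> (j < l)%N -> lambda H l j = 0.
Proof.
case: N hN k hk => // n _ k hk; rewrite -[n.+1.-1]/n in k hk *.
pose kn i : nat := if insub i is Some o then k o else 0%N.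
have knE (j : 'I_n) : kn j = k j by rewrite /kn valK.
have hkn i : (i < n)%N -> (i < kn i <= n)%N.
  by move=> iN; rewrite (knE (Ordinal iN)) leq_ord andbT; exact: (hk (Ordinal iN)).
have [q sq qsum] := sparse_family_sum_exists R hkn.
have [||H trigH HE] := @certp_surj R n q (sparse_root sq).
- by move=> j jn; apply: (sparse_at1 sq).
- by move=> j jn; apply: (sparse_size sq).
have HEj (j : 'I_n) : certp H j = q j by rewrite HE// ltnW.
have HEl (l : 'I_n.+1) : certp H l = q l by rewrite HE// leq_ord.
have pos (j : 'I_n) : 0 < lambda (N := n.+1) H (k j) j.
  by rewrite lambda_gt0 HEj HEl -knE (sparse_neg sq) /=.
have zero (j : 'I_n) (l : 'I_n.+1) : l != k j -> (j < l)%N -> lambda (N := n.+1) H l j = 0.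
  move=> lk jl; apply/eqP; rewrite lambda_eq0 HEj HEl (sparse_orth sq) ?leq_ord//.
  by rewrite knE val_eqE.
exists H; split; first (split; first split).
- apply: Hstar_of_certificates => //.
    by rewrite -qsum big_nat [RHS]big_nat; apply: eq_bigr => j jn; rewrite HE.
  move=> j l jl; rewrite !HE; [|lia|lia].
  by apply: (sparse_offdiag sq); lia.
- move=> j; exists (k j); split=> // l [jl]; apply: contraTeq => kl.
  by rewrite zero ?ltxx// eq_sym.
- by move=> j; split=> // l; apply: zero.
move=> H' [[H'star _] H'cond].
have trigH' : is_trig_mx H' by case: H'star.
(* Optimality of [H'] supplies the sum condition, and its certificates supply orthogonality and
   signs; only upper bounds on the degrees are known beforehand. *)
have eqq : forall j, (j <= n)%N -> certp H' j = q j.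
  apply: (sparse_family_unique hkn sq).
  - exact: certp_root.
  - by move=> i; apply: size_certp.
  - by move=> i iN; apply: certp_at1; rewrite ltn_eqF.
  - move=> i l /andP[il ln] lk; have iN : (i < n)%N by apply: leq_trans ln.
    have lN : (l < n.+1)%N by [].
    have [_ /(_ (Ordinal lN))] := H'cond (Ordinal iN).
    rewrite -val_eqE /= -(knE (Ordinal iN)) => /(_ lk il) /eqP.
    by rewrite lambda_eq0 => /eqP.
  - move=> i iN; have [+ _] := H'cond (Ordinal iN).
    by rewrite lambda_gt0 -knE.
  - by rewrite qsum certp_sum_of_Hstar.
apply: certp_inj => // j jn; first by rewrite HE// (sparse_size sq).
by rewrite HE// eqq.
Qed.
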